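(* Let $P=\{P_n(x)\}_{n=0}^\infty$ be a classical orthogonal polynomial sequence with generating function of one of the forms $$\phi(x,t)=\sum_{n=0}^\infty P_n(x)t^n\qquad\text{or}\qquad \psi(x,t)=\sum_{n=0}^\infty P_n(x)\frac{t^n}{n!}.$$ Let $M(y)=\frac{ay+b}{cy+d}$ with $a,b,c,d\in\mathbb{C}$, $ad-bc\ne0$, and set $R_n(y)=P_n(M(y))$ and $Q_n(y)=(cy+d)^nP_n(M(y))$. Then the corresponding generating functions of the sequence $\{R_n\}$ are $\Phi_R(y,t)=\phi(M(y),t)$ or $\Psi_R(y,t)=\psi(M(y),t)$, respectively, that is, $$\phi(M(y),t)=\sum_{n=0}^\infty R_n(y)t^n\qquad\text{or}\qquad\psi(M(y),t)=\sum_{n=0}^\infty R_n(y)\frac{t^n}{n!},$$ and the corresponding generating functions of the sequence $\{Q_n\}$ are $\Phi_Q(y,\tau)=\phi(M(y),(cy+d)\tau)$ or $\Psi_Q(y,\tau)=\psi(M(y),(cy+d)\tau)$, respectively, that is, $$\phi(M(y),(cy+d)\tau)=\sum_{n=0}^\infty Q_n(y)\tau^n\qquad\text{or}\qquad\psi(M(y),(cy+d)\tau)=\sum_{n=0}^\infty Q_n(y)\frac{\tau^n}{n!}.$$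
   Context: A classical orthogonal polynomial sequence is a sequence of polynomials $P_n$ with $\deg P_n=n$, orthogonal on an interval of the real line, whose members satisfy $f P_n''+gP_n'+h_nP_n=0$ with $f,g$ polynomials of degrees at most $2$ and $1$ independent of $n$ and $h_n$ constants (e.g. Jacobi, Laguerre, Hermite). Generating-function identities are understood as identities of power series in $t$ (or $\tau$), for $y$ with $cy+d\ne0$. *)

(* Defs.v *)
From HB Require Import structures.
From mathcomp Require Import all_boot all_order all_algebra.
From mathcomp Require Import all_classical all_reals all_analysis.
From mathcomp Require Import complex.

Set Implicit Arguments.
Unset Strict Implicit.
Unset Printing Implicit Defensive.

Import Order.TTheory GRing.Theory Num.Theory.
Import numFieldNormedType.Exports.

Local Open Scope classical_set_scope.
Local Open Scope ring_scope.
Local Open Scope complex_scope.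

(* Orthogonality with respect to a nonnegative weight with finite moments.
   Measurability of [w] on [I] is part of [integrable], and the positivity
   of the squared norms forces [I] to have nonempty interior. *)
Definition orthogonal_on_interval (R : realType) (P : nat -> {poly R}) : Prop :=
  exists (I : interval R) (w : R -> R),
  [/\ forall x, x \in I -> 0 <= w x,
      forall m n, (@lebesgue_measure R).-integrable [set` I]
                    (fun x => ((P m).[x] * (P n).[x] * w x)%:E),
      forall m n, m != n ->
        (\int[@lebesgue_measure R]_(x in [set` I])
           ((P m).[x] * (P n).[x] * w x)%:E = 0)%E
    & forall n,
        (0 < \int[@lebesgue_measure R]_(x in [set` I])
               ((P n).[x] * (P n).[x] * w x)%:E)%E].

(* The condition [f != 0] only rules out the vacuous equation f = g = h = 0:
   for f = 0 the cases n = 0, 1, 2 and orthogonality already force g = 0 and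
   every h n = 0. *)
Definition satisfies_classical_ode (R : realType) (P : nat -> {poly R}) : Prop :=
  exists (f g : {poly R}) (h : nat -> R),
  [/\ f != 0, (size f <= 3)%N, (size g <= 2)%N
    & forall n, f * (P n)^`(2) + g * (P n)^`() + h n *: P n = 0].

Definition classical_OPS (R : realType) (P : nat -> {poly R}) : Prop :=
  [/\ forall n, size (P n) = n.+1,
      orthogonal_on_interval P & satisfies_classical_ode P].

Definition evalC (R : realType) (p : {poly R}) (x : R[i]) : R[i] :=
  (map_poly (real_complex R) p).[x].

Definition mobius (K : fieldType) (a b c d y : K) : K :=
  (a * y + b) / (c * y + d).

Definition R_seq (R : realType) (P : nat -> {poly R}) (a b c d : R[i])
    (n : nat) (y : R[i]) : R[i] :=
  evalC (P n) (mobius a b c d y).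

Definition Q_seq (R : realType) (P : nat -> {poly R}) (a b c d : R[i])
    (n : nat) (y : R[i]) : R[i] :=
  (c * y + d) ^+ n * evalC (P n) (mobius a b c d y).

(* A formal power series in one variable is its sequence of coefficients. *)
Definition fps (K : Type) := nat -> K.

(* The substitution F(p(t)), meaningful when p has no constant term: the
   coefficient of t^n then only depends on the terms of F of degree <= n. *)
Definition fps_subst (K : comNzRingType) (F : fps K) (p : {poly K}) : fps K :=
  fun n => ((\poly_(k < n.+1) F k) \Po p)`_n.

(* F = \sum_n u_n t^n and F = \sum_n u_n t^n / n!, as formal power series. *)
Definition formal_ogf (K : numFieldType) (u : nat -> K) (F : fps K) : Prop :=
  forall n, F n = u n.

Definition formal_egf (K : numFieldType) (u : nat -> K) (F : fps K) : Prop :=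
  forall n, F n = u n / n`!%:R.

(* The same identities for a function F of t, the power series being
   convergent near t = 0. *)
Definition analytic_ogf (K : numFieldType) (u : nat -> K) (F : K -> K) : Prop :=
  \forall t \near (0 : K), series (fun n => u n * t ^+ n) @ \oo --> F t.

Definition analytic_egf (K : numFieldType) (u : nat -> K) (F : K -> K) : Prop :=
  \forall t \near (0 : K),
    series (fun n => u n * (t ^+ n / n`!%:R)) @ \oo --> F t.

(* Main.v *)
Require Import Defs.
From HB Require Import structures.
From mathcomp Require Import all_boot all_order all_algebra.
From mathcomp Require Import all_classical all_reals all_analysis.
From mathcomp Require Import complex.

Set Implicit Arguments.
Unset Strict Implicit.
Unset Printing Implicit Defensive.

Import Order.TTheory GRing.Theory Num.Theory.
Import numFieldNormedType.Exports.

Local Open Scope classical_set_scope.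
Local Open Scope ring_scope.
Local Open Scope complex_scope.

(** The identities for $R_n$ are the given ones at $x = M(y)$. For $Q_n$, put $k = cy+d$, which does
    not depend on $n$ or $\tau$: then $u_n (k\tau)^n = (k^n u_n)\tau^n$, so replacing $t$ by $k\tau$
    multiplies the $n$-th coefficient by $k^n$, which turns $P_n(M(y))$ into $Q_n(y)$. For formal
    series this is [fps_substZX]. For convergent series the partial sums agree term by term, and
    [near0_scale] keeps $k\tau$ in the neighbourhood of $0$ where the given series converges. *)

Lemma coef_comp_polyZX (K : comNzRingType) (p : {poly K}) (k : K) (n : nat) :
  (p \Po (k *: 'X))`_n = k ^+ n * p`_n.
Proof.
rewrite coef_comp_poly.
under eq_bigr => i _ do rewrite exprZn coefZ coefXn mulrCA.
have [ltnp|lepn] := ltnP n (size p).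
  rewrite (bigD1 (Ordinal ltnp)) //= eqxx mulr1 big1 ?addr0 // => i ni.
  by rewrite (_ : (n == i) = false) ?mulr0 // eq_sym; apply/negbTE.
(* Beyond the size of [p] no index of the sum equals [n], and the coefficient of [p] takes its
   default value 0. *)
rewrite nth_default // mulr0 big1 // => i _.
by rewrite gtn_eqF ?mulr0 // (leq_trans (ltn_ord i)).
Qed.

(** The truncation in [fps_subst] retains degrees up to [n] inclusive, so the one coefficient that
    contributes survives. *)
Lemma fps_substZX (K : comNzRingType) (F : fps K) (k : K) (n : nat) :
  fps_subst F (k *: 'X) n = k ^+ n * F n.
Proof. by rewrite /fps_subst coef_comp_polyZX coef_poly ltnSn. Qed.

(** Multiplication by [k] is continuous and fixes 0, so it pulls neighbourhoods of 0 back to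
    neighbourhoods of 0, also when [k] is 0. *)
Lemma near0_scale (K : numFieldType) (A : K -> Prop) (k : K) :
  (\forall t \near (0 : K), A t) -> \forall t \near (0 : K), A (k * t).
Proof.
move=> A0.
have k0 : k * t @[t --> (0 : K)] --> (0 : K).
  by rewrite -[X in _ --> X](mulr0 k); exact: mulrl_continuous.
exact: k0 A0.
Qed.

Lemma formal_ogf_scale (K : numFieldType) (u : nat -> K) (F : fps K) (k : K) :
  formal_ogf u F ->
  formal_ogf (fun n => k ^+ n * u n) (fps_subst F (k *: 'X)).
Proof. by move=> uF n; rewrite fps_substZX uF. Qed.

Lemma formal_egf_scale (K : numFieldType) (u : nat -> K) (F : fps K) (k : K) :
  formal_egf u F ->
  formal_egf (fun n => k ^+ n * u n) (fps_subst F (k *: 'X)).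
Proof. by move=> uF n; rewrite fps_substZX uF mulrA. Qed.

Lemma analytic_ogf_scale (K : numFieldType) (u : nat -> K) (F : K -> K) (k : K) :
  analytic_ogf u F ->
  analytic_ogf (fun n => k ^+ n * u n) (fun t => F (k * t)).
Proof.
move=> /(@near0_scale _ _ k); apply: filterS => t.
(* The factor [k ^+ n] moves from the power of [k * t] to the coefficient, so both sequences of
   partial sums coincide. *)
by under eq_fun => n do rewrite exprMn mulrCA mulrA.
Qed.

Lemma analytic_egf_scale (K : numFieldType) (u : nat -> K) (F : K -> K) (k : K) :
  analytic_egf u F ->
  analytic_egf (fun n => k ^+ n * u n) (fun t => F (k * t)).
Proof.
move=> /(@near0_scale _ _ k); apply: filterS => t.
by under eq_fun => n do rewrite exprMn -mulrA mulrCA mulrA.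
Qed.

Theorem theorem11 (R : realType) (P : nat -> {poly R}) (a b c d : R[i])
    (hP : classical_OPS P) (hM : a * d - b * c != 0) :
  [/\ forall phi : R[i] -> fps R[i],
        (forall x, formal_ogf (fun n => evalC (P n) x) (phi x)) ->
        forall y : R[i], c * y + d != 0 ->
          formal_ogf (fun n => R_seq P a b c d n y)
            (phi (mobius a b c d y)) /\
          formal_ogf (fun n => Q_seq P a b c d n y)
            (fps_subst (phi (mobius a b c d y)) ((c * y + d) *: 'X)),
      forall psi : R[i] -> fps R[i],
        (forall x, formal_egf (fun n => evalC (P n) x) (psi x)) ->
        forall y : R[i], c * y + d != 0 ->
          formal_egf (fun n => R_seq P a b c d n y)
            (psi (mobius a b c d y)) /\
          formal_egf (fun n => Q_seq P a b c d n y)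
            (fps_subst (psi (mobius a b c d y)) ((c * y + d) *: 'X)),
      forall phi : R[i] -> R[i] -> R[i],
        (forall x, analytic_ogf (fun n => evalC (P n) x) (phi x)) ->
        forall y : R[i], c * y + d != 0 ->
          analytic_ogf (fun n => R_seq P a b c d n y)
            (fun t => phi (mobius a b c d y) t) /\
          analytic_ogf (fun n => Q_seq P a b c d n y)
            (fun tau => phi (mobius a b c d y) ((c * y + d) * tau))
    & forall psi : R[i] -> R[i] -> R[i],
        (forall x, analytic_egf (fun n => evalC (P n) x) (psi x)) ->
        forall y : R[i], c * y + d != 0 ->
          analytic_egf (fun n => R_seq P a b c d n y)
            (fun t => psi (mobius a b c d y) t) /\
          analytic_egf (fun n => Q_seq P a b c d n y)
            (fun tau => psi (mobius a b c d y) ((c * y + d) * tau))].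
Proof.
(* [R_seq] unfolds to [evalC (P n)] at the Möbius image of [y], so [hF] closes all claims about it;
   the four scaling claims about [Q_seq] remain. *)
split=> F hF y _; split; try exact: hF.
- exact: formal_ogf_scale (hF _).
- exact: formal_egf_scale (hF _).
- exact: analytic_ogf_scale (hF _).
- exact: analytic_egf_scale (hF _).
Qed.
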